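(* Let $s$ be a fixed positive integer and let $\ell$ be any fixed positive integer. Let $p$ be a prime, let $\mathcal H=\{1,\ldots,H\}$ with $H\ge1$, let $L$ be an integer such that $L+\mathcal H=\{L+1,\ldots,L+H\}\subseteq\{1,\ldots,p-1\}$, let $\mathcal M\subseteq\mathbb F_p^*$ be a set of cardinality $\#\mathcal M=M\ge 1$, and let $a$ be an integer with $\gcd(a,p)=1$. Then $$\sum_{m\in\mathcal M}\left|\sum_{x\in L+\mathcal H}\mathbf e_p(amx^{-s})\right|\le HM\left(\frac{p}{MH^{2\ell/(\ell+1)}}+\frac1M\right)^{1/(2\ell)}p^{o(1)}.$$
   Context: $\mathbf e_p(z)=\exp(2\pi i z/p)$. $\mathbb F_p$ is the field of residue classes modulo the prime $p$, represented by $\{0,1,\ldots,p-1\}$; $\mathbb F_p^*$ is its set of non-zero elements; $x^{-s}$ is the inverse of $x^s$ computed modulo $p$. The factor $p^{o(1)}$ has exponent tending to $0$ as $p\to\infty$, for fixed $\ell$ and $s$, uniformly in $a$, $L$, $H$ and $\mathcal M$; that is, for every $\kappa>0$ it may be replaced by $p^{\kappa}$ for all primes $p$ sufficiently large in terms of $\kappa,\ell,s$. *)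

(* Defs.v *)
From mathcomp Require Import all_boot all_order all_algebra.
From mathcomp Require Import complex.
From mathcomp Require Import reals exp trigo.

Set Implicit Arguments.
Unset Strict Implicit.
Unset Printing Implicit Defensive.

Import Order.TTheory GRing.Theory Num.Theory.

Local Open Scope ring_scope.

(* exp(2 pi i z / p) for real z, through Euler's formula. *)
Definition ep (R : realType) (p : nat) (z : R) : R[i] :=
  Complex (cos (2 * pi * z / p%:R)) (sin (2 * pi * z / p%:R)).

(* A residue class enters ep through its representative in {0, ..., p - 1}. *)
Definition epF (R : realType) (p : nat) (u : 'F_p) : R[i] :=
  ep p (nat_of_ord u)%:R.

(* sum over x in L + {1, ..., H} of e_p(a m x^{-s}). *)
Definition inv_power_sum (R : realType) (p s H : nat) (L a : int) (m : 'F_p)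
    : R[i] :=
  \sum_(1 <= h < H.+1) epF R (a%:~R * m * ((L + h%:Z)%:~R : 'F_p) ^- s).

(* Main.v *)
Require Import Defs.
From mathcomp Require Import all_boot all_order all_algebra.
From mathcomp Require Import complex.
From mathcomp Require Import reals exp trigo.
From mathcomp Require Import zify ring lra.

(** The sums over [M] are compared with a moment over all frequencies: since
    [m |-> a m] is injective, Hoelder's inequality gives

      (sum_(m in M) |S(a m)|)^(2l) <= #|M|^(2l-1) sum_(lam : F_p) |S(lam)|^(2l),

    where [S(lam)] is the sum of [e_p(lam x^-s)] over the interval
    [X = {n+1, ..., n+H}].  By orthogonality the moment is [p] times the number
    of solutions in [X] of

      x_1^-s + ... + x_l^-s = y_1^-s + ... + y_l^-s,

    and everything rests on the bound
    [H^(2l) (1/p + H^(-2l/(l+1))) p^(1+o(1))] for that moment.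

    Write [k] for [l].  The interval is covered, uniformly and many times over,
    by the short progressions [a + t y], [0 <= y < h], with steps [t <= T],
    [h T <= H]; about [H T] pairs [(a, t)] occur.  Hoelder's inequality bounds
    the moment over [X] by an average of the moments over the progressions
    ([moment_by_progressions]).  Dividing by [t^-s], a coincidence on the
    progression [(a, t)] says that

      sum_j (b + f_j)^-s = sum_j (b + g_j)^-s   with b = a / t,

    [f] and [g] being [k]-tuples of numbers below [h].  If [g] is a rearrangement
    of [f] this holds for every pair [(a, t)], but there are only [O(h^k)] such
    [(f, g)] ([card_same_fibers]).  Otherwise [b] is a root of a nonzero
    polynomial of degree [O(k s)], so it has boundedly many values
    ([card_coincidences]).  The total number of coincidences is thus
    [O(H T h^k + m h^(2k))], where [m] bounds the number of pairs [(a, t)] with a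
    given quotient.

    The quotients may collide badly: for [L = 0] every pair [(t, t)] gives
    [b = 1].  The remedy is to use a step [t] at a point [x] only if, for every
    [d <= D], it divides neither the least positive nor the largest negative
    residue of [d x] modulo [p].  Two
    pairs with the same quotient whose steps differ by [d <= D] force such a
    divisibility, so on the remaining progressions the steps sharing a quotient
    are spaced by more than [D] ([good_progressions_fibre]).  By the divisor
    bound [tau(c) <= B = p^o(1)] for [c < p], each [d] forbids at most [2 B]
    steps; hence [D = T / (4 B)] keeps half of the steps at each point
    ([good_steps_large]) and still gives [m <= 4 B].

    Finally [T] of order [h^k / H] balances the two terms, and [h] is taken as
    large as [h^k <= p] and [h T <= H] permit, that is [h^k] of order
    [min(p, H^(2k/(k+1)))]; the moment is then [O(B p H^(2k) / h^k)]
    ([interval_moment]). *)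

Set Implicit Arguments.
Unset Strict Implicit.
Unset Printing Implicit Defensive.

Import Order.TTheory GRing.Theory Num.Theory.

(** * The divisor bound *)

(** A divisor of [q ^ e * m] is determined by its [q]-part, one of [e + 1] powers
    of [q], and by its part prime to [q], which divides [m]. *)
Lemma size_divisors_pfactorM (q e m : nat) : prime q -> (0 < m)%N -> ~~ (q %| m) ->
  (size (divisors (q ^ e * m)) <= e.+1 * size (divisors m))%N.
Proof.
move=> q_pr m_gt0 q_m.
have qe_gt0 : (0 < q ^ e)%N by rewrite expn_gt0 prime_gt0.
have n_gt0 : (0 < q ^ e * m)%N by rewrite muln_gt0 qe_gt0.
set s := [seq q ^ i * d | i <- iota 0 e.+1, d <- divisors m].
have -> : (e.+1 * size (divisors m))%N = size s by rewrite size_allpairs size_iota.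
apply: uniq_leq_size; first exact: divisors_uniq.
move=> d; rewrite -dvdn_divisors // => d_n.
have d_gt0 : (0 < d)%N := dvdn_gt0 n_gt0 d_n.
rewrite -[d](partnC q d_gt0) p_part; apply: allpairs_f.
- rewrite mem_iota /= add0n ltnS.
  have := dvdn_leq_log q n_gt0 d_n.
  by rewrite lognM // pfactorK // (_ : logn q m = 0%N) ?addn0 // lognE q_pr m_gt0 (negbTE q_m).
- rewrite -dvdn_divisors // -(@Gauss_dvdr _ (q ^ e)).
    exact: dvdn_trans (dvdn_part _ _) d_n.
  rewrite coprimeXr // coprime_sym prime_coprime // -(p'natE _ q_pr).
  exact: part_pnat.
Qed.

(** Linear growth against exponential growth, applied to [e / j]: from
    [e + 1 <= j (e/j + 1) <= j 2^(e/j)] by raising to the power [j]. *)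
Lemma succ_expn_le (e j : nat) : (0 < j)%N -> (e.+1 ^ j <= j ^ j * 2 ^ e)%N.
Proof.
move=> j_gt0.
have e_j : (e.+1 <= j * 2 ^ (e %/ j))%N.
  apply: leq_trans (_ : _ <= j * (e %/ j).+1)%N _; first by rewrite mulnC ltn_ceil.
  by rewrite leq_mul2l ltn_expl ?orbT.
apply: leq_trans (_ : _ <= (j * 2 ^ (e %/ j)) ^ j)%N _; first by rewrite leq_exp2r.
by rewrite expnMn -expnM leq_mul2l leq_pexp2l ?leq_divM ?orbT.
Qed.

(** Peel off the primes one at a time, from the largest.  A prime factor [q ^ e]
    multiplies the left side by [(e + 1) ^ j] and the right side by [q ^ e]; the
    constant [j ^ j] has to be paid for [q < 2 ^ j] only, because for larger [q]
    already [(e + 1) ^ j <= 2 ^ (j e) <= q ^ e]. *)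
Lemma divisor_bound_upto (j b n : nat) : (0 < j)%N -> (0 < n)%N ->
    (forall q, prime q -> q %| n -> q < b)%N ->
  (size (divisors n) ^ j <= (j ^ j) ^ minn b (2 ^ j) * n)%N.
Proof.
move=> j_gt0; have jj_gt0 : (0 < j ^ j)%N by rewrite expn_gt0 j_gt0.
elim: b n => [|b IHb] n n_gt0 small.
  case: (ltnP 1 n) => [n_gt1|n_le1].
    by have := small _ (pdiv_prime n_gt1) (pdiv_dvd n).
  have -> : n = 1%N by lia.
  by rewrite /= exp1n muln1 expn_gt0 jj_gt0.
have mono : ((j ^ j) ^ minn b (2 ^ j) <= (j ^ j) ^ minn b.+1 (2 ^ j))%N.
  by rewrite leq_pexp2l //; lia.
have [/andP[b_pr b_n]|nb] := boolP (prime b && (b %| n)); last first.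
  apply: leq_trans (IHb n n_gt0 _) _; last by rewrite leq_mul2r mono orbT.
  move=> q q_pr q_n; have := small q q_pr q_n.
  rewrite ltnS leq_eqVlt => /orP[/eqP q_b|//].
  by rewrite -q_b q_pr q_n in nb.
have [m b_m n_e] := pfactor_coprime b_pr n_gt0.
rewrite prime_coprime // in b_m.
have m_gt0 : (0 < m)%N by case: (posnP m) b_m => // ->; rewrite dvdn0.
set e := logn b n in n_e.
have e_gt0 : (0 < e)%N by rewrite logn_gt0 mem_primes b_pr n_gt0.
have b_gt1 := prime_gt1 b_pr.
have small_m q : prime q -> (q %| m)%N -> (q < b)%N.
  move=> q_pr q_m; have q_n : (q %| n)%N by rewrite n_e dvdn_mulr.
  have := small q q_pr q_n; rewrite ltnS leq_eqVlt => /orP[/eqP q_b|//].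
  by rewrite q_b (negbTE b_m) in q_m.
apply: leq_trans (_ : _ <= (e.+1 * size (divisors m)) ^ j)%N _.
  by rewrite leq_exp2r // {1}n_e mulnC size_divisors_pfactorM.
rewrite expnMn [in leqRHS]n_e.
apply: leq_trans (_ : _ <= e.+1 ^ j * ((j ^ j) ^ minn b (2 ^ j) * m))%N _.
  by rewrite leq_mul2l IHb ?orbT.
rewrite mulnA [(m * _)%N]mulnC [leqRHS]mulnA leq_mul2r; apply/orP; right.
rewrite mulnC; case: (ltnP b (2 ^ j)) => b_j.
  have -> : minn b.+1 (2 ^ j) = b.+1 by lia.
  rewrite expnSr -mulnA leq_mul2l; apply/orP; right.
  apply: leq_trans (succ_expn_le e j_gt0) _.
  by rewrite leq_mul2l leq_exp2r ?b_gt1 ?orbT.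
have -> : minn b.+1 (2 ^ j) = (2 ^ j)%N by lia.
rewrite leq_mul2l; apply/orP; right.
apply: leq_trans (_ : _ <= (2 ^ e) ^ j)%N _.
  by rewrite leq_exp2r // ltn_expl.
by rewrite -expnM mulnC expnM leq_exp2r.
Qed.

(** That is, [tau(n) = O(n ^ (1 / j))]. *)
Lemma divisor_bound (j : nat) : (0 < j)%N ->
  exists C : nat, forall n, (0 < n)%N -> (size (divisors n) ^ j <= C * n)%N.
Proof.
move=> j_gt0; exists ((j ^ j) ^ 2 ^ j)%N => n n_gt0.
apply: leq_trans (@divisor_bound_upto j n.+1 n j_gt0 n_gt0 _) _.
  by move=> q _ q_n; rewrite ltnS dvdn_leq.
by rewrite leq_mul2r leq_pexp2l ?geq_minr ?orbT // expn_gt0 j_gt0.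
Qed.

Local Open Scope ring_scope.

Local Notation normc := ComplexField.Normc.normc.

(** * Additive characters modulo a prime and moments of exponential sums *)

Lemma epD (R : realType) (p : nat) (x y : R) : ep p (x + y) = ep p x * ep p y.
Proof.
rewrite /ep mulrDr mulrDl cosD sinD /GRing.mul /=; congr (Complex _ _).
by rewrite addrC; congr (_ + _); rewrite mulrC.
Qed.

Lemma ep_natM (R : realType) (p n : nat) : (0 < p)%N -> ep p (n%:R * p%:R : R) = 1.
Proof.
move=> p_gt0; elim: n => [|n IHn].
  by rewrite /ep mul0r mulr0 mul0r cos0 sin0.
rewrite -natr1 mulrDl mul1r epD IHn mul1r /ep mulfK ?pnatr_eq0 -?lt0n //.
by rewrite mulr_natl cos2pi sin2pi.
Qed.

Lemma epF_nat (R : realType) (p n : nat) : prime p -> epF R (n%:R : 'F_p) = ep p n%:R.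
Proof.
move=> p_pr; rewrite /epF val_Fp_nat // [in RHS](divn_eq n p) natrD epD natrM.
by rewrite ep_natM ?mul1r ?prime_gt0.
Qed.

Lemma epFD (R : realType) (p : nat) (u v : 'F_p) : prime p ->
  epF R (u + v) = epF R u * epF R v.
Proof.
move=> p_pr; rewrite -{1}[u]natr_Zp -{1}[v]natr_Zp -natrD epF_nat //.
by rewrite natrD epD.
Qed.

Lemma epF0 (R : realType) (p : nat) : epF R (0 : 'F_p) = 1.
Proof. by rewrite /epF /= /ep mulr0 mul0r cos0 sin0. Qed.

(** If [u] is not zero then [t = pi u / p] lies strictly between [0] and [pi],
    so that [cos (2 t) = 1 - 2 sin^2 t < 1]. *)
Lemma epF_eq1 (R : realType) (p : nat) (u : 'F_p) : prime p -> epF R u = 1 -> u = 0.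
Proof.
move=> p_pr; rewrite /epF /ep => -[cos_u _]; apply/eqP; apply: contraT => u_neq0.
have p_gt0 : (0 : R) < p%:R by rewrite ltr0n prime_gt0.
have u_gt0 : (0 : R) < (nat_of_ord u)%:R by rewrite ltr0n lt0n.
have u_lt : (nat_of_ord u)%:R < (p%:R : R).
  by rewrite ltr_nat -[X in (_ < X)%N](Fp_cast p_pr).
set t : R := pi * (nat_of_ord u)%:R / p%:R.
have t_pi : 0 < t < pi.
  have pi0 := pi_gt0 R.
  rewrite /t divr_gt0 ?mulr_gt0 //= ltr_pdivrMr // ltr_pM2l //.
have := sin_gt0_pi t_pi; have := cos_mulr2n t.
have -> : t *+ 2 = 2 * pi * (nat_of_ord u)%:R / p%:R by rewrite /t; ring.
rewrite cos_u cos2sin2 => h s0; have := exprn_gt0 2 s0; lra.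
Qed.

Lemma epF_conj (R : realType) (p : nat) (u : 'F_p) : prime p ->
  (epF R u)^*%C = epF R (- u).
Proof.
move=> p_pr.
have e1 : epF R u * epF R (- u) = 1 by rewrite -epFD // subrr epF0.
have e2 : epF R u * (epF R u)^*%C = 1.
  rewrite /epF /ep /GRing.mul /= mulrN opprK -!expr2 cos2Dsin2.
  by rewrite mulrN mulrC addNr.
have u_neq0 : epF R u != 0.
  by apply/eqP => e0; move: e1; rewrite e0 mul0r => /eqP; rewrite eq_sym oner_eq0.
by apply: (mulfI u_neq0); rewrite e1 e2.
Qed.

Lemma epF_sum (R : realType) (p : nat) (I : finType) (F : I -> 'F_p) : prime p ->
  epF R (\sum_i F i) = \prod_i epF R (F i).
Proof.
move=> p_pr; apply: (big_morph (fun u => epF R u)); last exact: epF0.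
by move=> u v; apply: epFD.
Qed.

(** For nonzero [u], shifting [lam] by one multiplies the sum by [e_p(u)], which
    differs from one. *)
Lemma epF_orthogonality (R : realType) (p : nat) (u : 'F_p) : prime p ->
  \sum_(lam : 'F_p) epF R (lam * u) = (if u == 0 then p else 0)%:R.
Proof.
move=> p_pr; case: eqVneq => [->|u_neq0].
  under eq_bigr do rewrite mulr0 epF0.
  by rewrite sumr_const card_Fp.
set S := LHS.
have S_shift : S = epF R u * S.
  rewrite {1}/S (reindex_inj (addIr 1)) /= mulr_sumr; apply: eq_bigr => x _.
  by rewrite mulrDl mul1r addrC epFD.
have /eqP : (1 - epF R u) * S = 0 by rewrite mulrBl mul1r -S_shift subrr.
rewrite mulf_eq0 subr_eq0 => /orP[/eqP e1|/eqP //].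
by move/esym/(epF_eq1 p_pr): e1 => e0; rewrite e0 eqxx in u_neq0.
Qed.

(** The coefficients are real so that moments become weighted counts with real
    weights, which are monotone in the coefficients ([moment_le]). *)
Definition expsum (R : realType) (p : nat) (I : finType) (c : I -> R) (phi : I -> 'F_p)
  (lam : 'F_p) : R[i] := \sum_i real_complex R (c i) * epF R (lam * phi i).

(** Expand [S^k * conj(S)^k] over pairs of [k]-tuples; orthogonality keeps the
    pairs with equal sums. *)
Lemma moment_count (R : realType) (p k : nat) (I : finType) (c : I -> R) (phi : I -> 'F_p) :
    prime p ->
  \sum_lam normc (expsum c phi lam) ^+ (2 * k) =
  p%:R * \sum_(f : {ffun 'I_k -> I}) \sum_(g : {ffun 'I_k -> I})
    (if \sum_j phi (f j) == \sum_j phi (g j) then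
       (\prod_j c (f j)) * \prod_j c (g j) else 0).
Proof.
move=> p_pr; apply: (@complexI R).
rewrite rmorph_sum rmorphM rmorph_nat rmorph_sum /=.
have expS lam : expsum c phi lam ^+ k =
    \sum_(f : {ffun 'I_k -> I}) real_complex R (\prod_j c (f j)) * epF R (lam * \sum_j phi (f j)).
  rewrite -[X in _ ^+ X]card_ord -prodr_const.
  rewrite /expsum (bigA_distr_bigA (fun _ i => real_complex R (c i) * epF R (lam * phi i))).
  apply: eq_bigr => f _.
  by rewrite big_split /= rmorph_prod mulr_sumr epF_sum.
have conjS lam : (expsum c phi lam ^+ k)^*%C =
    \sum_(g : {ffun 'I_k -> I}) real_complex R (\prod_j c (g j))
      * epF R (- (lam * \sum_j phi (g j))).
  rewrite expS [LHS](rmorph_sum (@conjc R)); apply: eq_bigr => g _.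
  apply: etrans (rmorphM (@conjc R) _ _) _.
  by congr (_ * _); [exact: conjc_real | exact: epF_conj].
have normS lam : real_complex R (normc (expsum c phi lam) ^+ (2 * k)) =
    \sum_(f : {ffun 'I_k -> I}) \sum_(g : {ffun 'I_k -> I})
      real_complex R ((\prod_j c (f j)) * \prod_j c (g j))
      * epF R (lam * (\sum_j phi (f j) - \sum_j phi (g j))).
  have normE : real_complex R (normc (expsum c phi lam)) = `|expsum c phi lam| by [].
  rewrite rmorphXn /= exprM normE normCK exprMn.
  have -> : Num.conj (expsum c phi lam) ^+ k = (expsum c phi lam ^+ k)^*%C.
    exact/esym/(rmorphXn (@conjc R)).
  rewrite conjS expS mulr_suml; apply: eq_bigr => f _.
  rewrite mulr_sumr; apply: eq_bigr => g _.
  rewrite mulrBr epFD // (rmorphM (real_complex R)).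
  by rewrite -!mulrA; congr (_ * _); rewrite mulrCA.
under eq_bigr do rewrite normS.
rewrite exchange_big mulr_sumr; apply: eq_bigr => f _ /=.
rewrite exchange_big rmorph_sum mulr_sumr; apply: eq_bigr => g _ /=.
rewrite -mulr_sumr epF_orthogonality // subr_eq0; case: eqP => _.
  by rewrite mulrC.
by rewrite !mulr0.
Qed.

Lemma moment_le (R : realType) (p k : nat) (I : finType) (c d : I -> R) (phi : I -> 'F_p) :
    prime p -> (forall i, 0 <= c i <= d i) ->
  \sum_lam normc (expsum c phi lam) ^+ (2 * k) <=
  \sum_lam normc (expsum d phi lam) ^+ (2 * k).
Proof.
move=> p_pr cd; rewrite !moment_count // ler_wpM2l ?ler0n //.
have c0 i : 0 <= c i by have /andP[] := cd i.
have prod_cd (h : {ffun 'I_k -> I}) : 0 <= \prod_j c (h j) <= \prod_j d (h j).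
  by rewrite prodr_ge0 // ler_prod.
apply: ler_sum => f _; apply: ler_sum => g _; case: ifP => // _.
have /andP[f0 fd] := prod_cd f; have /andP[g0 gd] := prod_cd g.
exact: ler_pM.
Qed.

Lemma moment_indicator (R : realType) (p k : nat) (I : finType) (v : pred I) (phi : I -> 'F_p) :
    prime p ->
  \sum_lam normc (expsum (fun i => (v i)%:R : R) phi lam) ^+ (2 * k) =
  (p * #|[set fg : {ffun 'I_k -> I} * {ffun 'I_k -> I} |
     [&& [forall j, v (fg.1 j)], [forall j, v (fg.2 j)] &
       \sum_j phi (fg.1 j) == \sum_j phi (fg.2 j)]]|)%:R.
Proof.
move=> p_pr; rewrite moment_count // natrM; congr (_ * _).
have prod_ind (h : {ffun 'I_k -> I}) : \prod_j (v (h j))%:R = [forall j, v (h j)]%:R :> R.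
  case: forallP => [vh|nvh]; first by rewrite big1 // => j _; rewrite vh.
  have [j nj] : exists j, ~~ v (h j).
    by apply/existsP; rewrite -negb_forall; apply/forallP.
  by rewrite (bigD1 j) //= (negbTE nj) mul0r.
rewrite pair_bigA /= -sum1_card natr_sum [RHS]big_mkcond /=.
apply: eq_bigr => -[f g] _; rewrite !prod_ind inE /=.
by do 2!case: [forall _, _]; case: eqP; rewrite /= ?mulr1 ?mulr0 ?mul0r.
Qed.

(** Induction on the exponent, each step being Chebyshev's sum inequality for the
    two similarly ordered families [x] and [x ^ (n + 1)]. *)
Lemma power_mean (R : realFieldType) (I : finType) (E : {set I}) (n : nat) (x : I -> R) :
    (forall i, 0 <= x i) ->
  (\sum_(i in E) x i) ^+ n.+1 <= #|E|%:R ^+ n * \sum_(i in E) x i ^+ n.+1.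
Proof.
move=> x_ge0; elim: n => [|n IHn]; first by rewrite expr1 expr0 mul1r.
(* The double sum of (x_i - x_j)(x_i^(n+1) - x_j^(n+1)) has nonnegative terms. *)
have chebyshev : (\sum_(i in E) x i) * (\sum_(i in E) x i ^+ n.+1)
    <= #|E|%:R * \sum_(i in E) x i ^+ n.+2.
  set A := \sum_(i in E) x i; set B := \sum_(i in E) _; set D := \sum_(i in E) _.
  have : 0 <= \sum_(i in E) \sum_(j in E) (x i - x j) * (x i ^+ n.+1 - x j ^+ n.+1).
    apply: sumr_ge0 => i _; apply: sumr_ge0 => j _.
    case: (lerP (x j) (x i)) => [xji|/ltW xij].
      by rewrite mulr_ge0 ?subr_ge0 ?lerXn2r ?nnegrE.
    by rewrite mulr_le0 ?subr_le0 ?lerXn2r ?nnegrE.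
  have -> : \sum_(i in E) \sum_(j in E) (x i - x j) * (x i ^+ n.+1 - x j ^+ n.+1)
      = 2 * (#|E|%:R * D - A * B).
    transitivity (\sum_(i in E) (#|E|%:R * x i ^+ n.+2 - x i * B - A * x i ^+ n.+1 + D)).
      apply: eq_bigr => i _; rewrite /A /B /D mulr_sumr mulr_suml.
      have -> : #|E|%:R * x i ^+ n.+2 = \sum_(j in E) x i ^+ n.+2.
        by rewrite sumr_const mulr_natl.
      rewrite -!sumrB -big_split /=; apply: eq_bigr => j _.
      by rewrite !exprS; ring.
    rewrite big_split !sumrB /= -!mulr_sumr -mulr_suml -/A -/B -/D sumr_const -mulr_natl.
    by ring.
  by rewrite pmulr_rge0 // subr_ge0.
rewrite exprS; apply: le_trans (_ : _ <= (\sum_(i in E) x i) *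
   (#|E|%:R ^+ n * \sum_(i in E) x i ^+ n.+1)) _.
  by rewrite ler_wpM2l // sumr_ge0.
rewrite mulrCA exprSr -mulrA ler_wpM2l // exprn_ge0 //.
Qed.

Lemma normc_sum (R : realType) (I : finType) (E : {set I}) (z : I -> R[i]) :
  normc (\sum_(i in E) z i) <= \sum_(i in E) normc (z i).
Proof.
elim/big_ind2: _ => [|x1 x2 y1 y2 h1 h2|//]; first by rewrite ComplexField.Normc.normc0.
exact: le_trans (le_normcD _ _) (lerD h1 h2).
Qed.

Lemma normc_ge0 (R : realType) (z : R[i]) : 0 <= normc z.
Proof. by case: z => a b; apply: sqrtr_ge0. Qed.

(** Hoelder's inequality for a finite family of functions of the frequency. *)
Lemma moment_holder (R : realType) (I J : finType) (E : {set J}) (n : nat)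
    (S : J -> I -> R[i]) :
  \sum_lam normc (\sum_(e in E) S e lam) ^+ n.+1 <=
  #|E|%:R ^+ n * \sum_(e in E) \sum_lam normc (S e lam) ^+ n.+1.
Proof.
rewrite exchange_big mulr_sumr; apply: ler_sum => lam _ /=.
apply: le_trans (power_mean E n (fun e => normc_ge0 (S e lam))).
by rewrite lerXn2r ?nnegrE ?normc_ge0 ?normc_sum ?sumr_ge0 // => e _; apply: normc_ge0.
Qed.

(** * Coincidences between sums of inverse powers *)

(** Clearing the denominators gives the polynomial [P] below, of degree less than
    [s * #|V|].  It is nonzero because at the pole [- r v0] all its terms vanish
    but the one of [v0]. *)
Lemma card_roots_inv_powers (F : finFieldType) (I : finType) (V : {set I}) (r n : I -> F)
    (v0 : I) (s : nat) :
    (0 < s)%N -> injective r -> v0 \in V -> n v0 != 0 ->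
  (#|[set b : F | [forall v in V, b + r v != 0]%R &&
        (\sum_(v in V) n v * (b + r v) ^- s == 0)%R]| <= s * #|V|)%N.
Proof.
move=> s_gt0 r_inj Vv0 n0.
pose P : {poly F} := \sum_(v in V) n v *: \prod_(w in V | w != v) ('X + (r w)%:P) ^+ s.
have P_at (b : F) :
    P.[b] = \sum_(v in V) n v * \prod_(w in V | w != v) (b + r w) ^+ s.
  rewrite /P horner_sum; apply: eq_bigr => v _.
  rewrite hornerZ horner_prod; congr (_ * _); apply: eq_bigr => w _.
  by rewrite horner_exp hornerD hornerX hornerC.
have P_neq0 : P != 0.
  apply/eqP => P0; have := P_at (- r v0); rewrite P0 horner0 (bigD1 v0) //=.
  rewrite [X in _ + X]big1 => [|v /andP[Vv v_v0]]; last first.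
    by rewrite (bigD1 v0) /= ?Vv0 1?eq_sym ?v_v0 // addNr expr0n gtn_eqF // mul0r mulr0.
  move/esym/eqP; rewrite addr0 mulf_eq0 (negbTE n0) /=.
  apply/negP; apply/prodf_neq0 => w /andP[_ w_v0].
  by rewrite expf_neq0 // addrC subr_eq0; apply: contraNneq w_v0 => /r_inj ->.
have size_P : (size P <= (s * #|V|).+1)%N.
  apply: (leq_trans (size_sum _ _ _)); apply/bigmax_leqP => v Vv.
  apply: (leq_trans (size_scale_leq _ _)).
  rewrite size_prod => [|w _]; last by rewrite expf_neq0 // -size_poly_eq0 size_XaddC.
  have size_factor (w : I) : size (('X + (r w)%:P) ^+ s) = s.+1.
    rewrite polySpred ?size_exp ?size_XaddC ?mul1n //.
    by rewrite expf_neq0 // -size_poly_eq0 size_XaddC.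
  under eq_bigr do rewrite size_factor.
  rewrite sum_nat_const mulnS subSn ?leq_addr // addnC addnK ltnS mulnC leq_mul2l.
  by rewrite subset_leq_card ?orbT //; apply/subsetP => w /andP[].
set B := [set b | _].
rewrite -ltnS; apply: leq_trans size_P; rewrite cardE.
apply: max_poly_roots => //; last exact: enum_uniq.
apply/allP => b; rewrite mem_enum inE => /andP[/forall_inP b_reg /eqP b_sum].
rewrite /root P_at; apply/eqP.
transitivity ((\sum_(v in V) n v * (b + r v) ^- s) * \prod_(w in V) (b + r w) ^+ s).
  rewrite mulr_suml; apply: eq_bigr => v Vv; rewrite -mulrA (bigD1 v Vv) /=.
  by rewrite mulKf // expf_neq0 // b_reg.
by rewrite b_sum mul0r.
Qed.

Definition same_fibers (J I : finType) (f g : {ffun J -> I}) : bool :=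
  [forall v, #|[set j | f j == v]| == #|[set j | g j == v]|].

(** Such a [g] takes its values among those of [f], hence is [f] composed with
    some map of [J] to itself.  This overcounts the rearrangements, which costs
    only a constant depending on [#|J|]. *)
Lemma card_same_fibers (J I : finType) :
  (#|[set fg : {ffun J -> I} * {ffun J -> I} | same_fibers fg.1 fg.2]|
    <= #|I| ^ #|J| * #|J| ^ #|J|)%N.
Proof.
pose rearrange (u : {ffun J -> I} * {ffun J -> J}) := (u.1, [ffun j => u.1 (u.2 j)]).
apply: leq_trans (_ : _ <= #|[set rearrange u | u in setT]|)%N _; last first.
  by rewrite (leq_trans (leq_imset_card _ _)) // cardsT card_prod !card_ffun.
apply/subset_leq_card/subsetP => -[f g]; rewrite inE /= => /forallP fg.
have g_im j : {i | f i == g j}.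
  apply: sigW; have /eqP e := fg (g j).
  have [i fi|f_im] := pickP (fun i => f i == g j); first by exists i.
  have : j \in [set i | g i == g j] by rewrite inE.
  rewrite (card0_eq _) ?inE // -e; apply: eq_card0 => i.
  by rewrite inE f_im.
apply/imsetP; exists (f, [ffun j => sval (g_im j)]) => //.
congr (_, _); apply/ffunP => j; rewrite !ffunE.
by have /eqP := svalP (g_im j).
Qed.

(** Collecting equal values of [f] and [g] turns the equation into a combination
    of inverse powers at distinct points, whose coefficients are differences of
    multiplicities.  They are smaller than [p] in absolute value, so the one at a
    value where [f] and [g] disagree does not vanish modulo [p]. *)
Lemma card_coincidences (p s k h : nat) (f g : {ffun 'I_k -> 'I_h}) :
    prime p -> (0 < s)%N -> (k < p)%N -> (h <= p)%N -> ~~ same_fibers f g ->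
  (#|[set b : 'F_p | [&& [forall j, b + (f j)%:R != 0]%R, [forall j, b + (g j)%:R != 0]%R &
       (\sum_j (b + (f j)%:R) ^- s == \sum_j (b + (g j)%:R) ^- s)%R]]| <= s * (2 * k))%N.
Proof.
move=> p_pr s_gt0 k_p h_p /forallPn[v0 fg].
have nat_inj (a b : nat) : (a < p)%N -> (b < p)%N -> a%:R = b%:R :> 'F_p -> a = b.
  by move=> a_p b_p /(congr1 val); rewrite /= !val_Fp_nat // !modn_small.
have r_inj : injective (fun v : 'I_h => (v : nat)%:R : 'F_p).
  by move=> u v /nat_inj e; apply/val_inj/e; apply: leq_trans (ltn_ord _) h_p.
pose V := [set f j | j in setT] :|: [set g j | j in setT].
pose n (v : 'I_h) : 'F_p := #|[set j | f j == v]|%:R - #|[set j | g j == v]|%:R.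
have card_lt_p (X : {set 'I_k}) : (#|X| < p)%N.
  by apply: leq_ltn_trans k_p; rewrite -[X in (_ <= X)%N]card_ord max_card.
have n0 : n v0 != 0.
  by rewrite subr_eq0; apply: contra fg => /eqP/nat_inj ->.
have Vf j : f j \in V by rewrite inE; apply/orP; left; apply/imsetP; exists j.
have Vg j : g j \in V by rewrite inE; apply/orP; right; apply/imsetP; exists j.
have Vv0 : v0 \in V.
  apply: contraR fg => Vv0; apply/eqP; transitivity 0%N; last apply/esym.
    by apply: eq_card0 => j; rewrite inE; apply: contraNF Vv0 => /eqP <-.
  by apply: eq_card0 => j; rewrite inE; apply: contraNF Vv0 => /eqP <-.
have card_V : (#|V| <= 2 * k)%N.
  rewrite (leq_trans (leq_card_setU _ _)) // mul2n -addnn.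
  by apply: leq_add; rewrite (leq_trans (leq_imset_card _ _)) // cardsT card_ord.
apply: leq_trans (_ : _ <= s * #|V|)%N _; last by rewrite leq_mul2l card_V orbT.
apply: leq_trans (card_roots_inv_powers s_gt0 r_inj Vv0 n0).
apply/subset_leq_card/subsetP => b; rewrite !inE => /and3P[/forallP bf /forallP bg /eqP e].
apply/andP; split.
  by apply/forall_inP => v; rewrite inE => /orP[] /imsetP[j _ ->].
have fibers (u : {ffun 'I_k -> 'I_h}) : (forall j, u j \in V) ->
    \sum_j (b + (u j)%:R) ^- s = \sum_(v in V) #|[set j | u j == v]|%:R * (b + (v : nat)%:R) ^- s.
  move=> Vu; rewrite (partition_big u (mem V)) //=; apply: eq_bigr => v _.
  rewrite mulr_natl -sumr_const; apply: eq_big => j; first by rewrite inE.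
  by move=> /eqP ->.
apply/eqP; under eq_bigr do rewrite mulrBl.
by rewrite sumrB -!fibers // e subrr.
Qed.

(** * From the interval to short progressions *)

Lemma normc_natM (R : realType) (n : nat) (z : R[i]) :
  normc (n%:R * z) = n%:R * normc z.
Proof. by rewrite mulr_natl normcMn mulr_natl. Qed.

Lemma expsumZ (R : realType) (p n : nat) (I : finType) (c : I -> R) (phi : I -> 'F_p) lam :
  expsum (fun i => n%:R * c i) phi lam = n%:R * expsum c phi lam.
Proof.
rewrite /expsum mulr_sumr; apply: eq_bigr => i _.
by rewrite rmorphM /= rmorph_nat mulrA.
Qed.

(** The progression of the pair [e = (a, t)] consists of the points
    [a + (t + 1) y]: steps are indexed from zero.  It is truncated to the points
    of [X] at which its step is allowed by [G]. *)
Section Progressions.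

Variables (p s k h T : nat).
Hypotheses (p_pr : prime p) (s_gt0 : (0 < s)%N) (k_gt0 : (0 < k)%N) (k_p : (k < p)%N).
Hypotheses (h_p : (h <= p)%N) (T_p : (T < p)%N).

Variables (X : {set 'F_p}) (G : 'F_p -> {set 'I_T}).
Hypotheses (X0 : 0 \notin X) (G_large : forall x, x \in X -> (T <= 2 * #|G x|)%N).

Let point (e : 'F_p * 'I_T) (y : 'I_h) : 'F_p := e.1 + e.2.+1%:R * (y : nat)%:R.
Let admissible e : pred 'I_h := fun y => (point e y \in X) && (e.2 \in G (point e y)).

Variables (E : {set 'F_p * 'I_T}) (m : nat).
Hypothesis E_admissible : forall e y, admissible e y -> e \in E.
Hypothesis E_fibre : forall b : 'F_p, (#|[set t : 'I_T | (b * t.+1%:R, t) \in E]%R| <= m)%N.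

Let step_neq0 (t : 'I_T) : t.+1%:R != 0 :> 'F_p.
Proof.
apply/eqP => /(congr1 val); rewrite /= val_Fp_nat // modn_small //.
by apply: leq_ltn_trans T_p; apply: ltn_ord.
Qed.

(** A pair of tuples that contributes to the moment over the progression [e]. *)
Let coincidence (e : 'F_p * 'I_T) (fg : {ffun 'I_k -> 'I_h} * {ffun 'I_k -> 'I_h}) : bool :=
  [&& [forall j, admissible e (fg.1 j)], [forall j, admissible e (fg.2 j)] &
     \sum_j point e (fg.1 j) ^- s == \sum_j point e (fg.2 j) ^- s].

(** The quotient [a / t] of the pair [(a, t)] is one of boundedly many roots, and
    each quotient is shared by at most [m] pairs. *)
Let card_coincidence_distinct fg : ~~ same_fibers fg.1 fg.2 ->
  (#|[set e in E | coincidence e fg]| <= m * (s * (2 * k)))%N.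
Proof.
move=> fg_distinct; set B := [set b : 'F_p | [&& [forall j, b + (fg.1 j)%:R != 0]%R,
  [forall j, b + (fg.2 j)%:R != 0]%R &
  (\sum_j (b + (fg.1 j)%:R) ^- s == \sum_j (b + (fg.2 j)%:R) ^- s)%R]].
have card_B : (#|B| <= s * (2 * k))%N by apply: card_coincidences.
have in_B e : coincidence e fg -> e.1 / e.2.+1%:R \in B.
  have pointE y : point e y = e.2.+1%:R * (e.1 / e.2.+1%:R + (y : nat)%:R).
    by rewrite mulrDr mulrCA mulfV ?mulr1.
  have point_neq0 y : admissible e y -> e.1 / e.2.+1%:R + (y : nat)%:R != 0.
    case/andP => Xy _; apply: contraNneq X0 => b0.
    by move: Xy; rewrite pointE b0 mulr0.
  case/and3P => /forallP hf /forallP hg /eqP e_fg; rewrite inE; apply/and3P; split.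
  - by apply/forallP => j; apply: point_neq0.
  - by apply/forallP => j; apply: point_neq0.
  - apply/eqP/(mulfI (expf_neq0 s (invr_neq0 (step_neq0 e.2)))).
    rewrite !mulr_sumr; move: e_fg; under eq_bigr do rewrite pointE exprMn invfM -exprVn.
    by move=> ->; apply: eq_bigr => j _; rewrite pointE exprMn invfM -exprVn.
pose Q := [set bt : 'F_p * 'I_T | (bt.1 \in B) && ((bt.1 * bt.2.+1%:R, bt.2) \in E)].
have card_Q : (#|Q| <= m * (s * (2 * k)))%N.
  apply: leq_trans (_ : _ <= m * #|B|)%N _; last by rewrite leq_mul2l card_B orbT.
  have -> : #|Q| = (\sum_(b in B) #|[set t : 'I_T | (b * t.+1%:R, t) \in E]%R|)%N.
    rewrite -sum1_card (eq_bigl (fun bt : 'F_p * 'I_T => (bt.1 \in B) && ((bt.1 * bt.2.+1%:R, bt.2) \in E))).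
      rewrite -(pair_big_dep (mem B) (fun (b : 'F_p) (t : 'I_T) => (b * t.+1%:R, t) \in E) (fun _ _ => 1%N)) /=.
      by apply: eq_bigr => b _; rewrite -sum1_card; apply: eq_bigl => t; rewrite inE.
    by move=> bt; rewrite inE.
  by rewrite mulnC -sum_nat_const leq_sum.
apply: leq_trans card_Q.
apply: leq_trans (leq_imset_card (fun bt : 'F_p * 'I_T => (bt.1 * bt.2.+1%:R, bt.2)) Q).
apply/subset_leq_card/subsetP => e; rewrite inE => /andP[Ee e_fg].
apply/imsetP; exists (e.1 / e.2.+1%:R, e.2).
  by rewrite inE /= in_B //= divfK // -surjective_pairing.
by rewrite /= divfK // -surjective_pairing.
Qed.

Let sum_card_coincidence :
  (\sum_(e in E) #|[set fg | coincidence e fg]|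
     <= #|E| * (h ^ k * k ^ k) + m * (s * (2 * k)) * h ^ (2 * k))%N.
Proof.
have -> : (\sum_(e in E) #|[set fg | coincidence e fg]|)%N =
    (\sum_fg #|[set e in E | coincidence e fg]|)%N.
  transitivity (\sum_(e in E) \sum_(fg | coincidence e fg) 1)%N.
    by apply: eq_bigr => e _; rewrite -sum1_card; apply: eq_bigl => fg; rewrite inE.
  rewrite (exchange_big_dep predT) //=; apply: eq_bigr => fg _.
  by rewrite -sum1_card; apply: eq_bigl => e; rewrite inE.
rewrite (bigID (fun fg => same_fibers fg.1 fg.2)) /=; apply: leq_add.
  apply: leq_trans (_ : _ <= \sum_(fg | same_fibers fg.1 fg.2) #|E|)%N _.
    by apply: leq_sum => fg _; apply/subset_leq_card/subsetP => e; rewrite inE => /andP[].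
  rewrite sum_nat_const mulnC leq_mul2l; apply/orP; right.
  have := card_same_fibers 'I_k 'I_h; rewrite !card_ord; apply: leq_trans.
  by apply/subset_leq_card/subsetP => fg; rewrite inE.
apply: leq_trans (_ : _ <= \sum_(fg | ~~ same_fibers fg.1 fg.2) m * (s * (2 * k)))%N _.
  by apply: leq_sum => fg; apply: card_coincidence_distinct.
rewrite sum_nat_const mulnC leq_mul2l; apply/orP; right.
apply: leq_trans (max_card _) _.
by rewrite card_prod !card_ffun !card_ord mul2n -addnn expnD.
Qed.

(** Weighting the point [x] by [2 #|G x| / T >= 1] can only increase the moment.
    The sum weighted by [#|G x|], taken [h] times, is the sum over all progressions:
    for each allowed step [t] and each [y < h], the point [x] is the [y]-th one of
    exactly one progression of step [t]. *)
Lemma moment_by_progressions (R : realType) :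
  ((T * h) ^ (2 * k))%:R *
    \sum_lam normc (expsum (fun x => (x \in X)%:R : R) (fun x => x ^- s) lam) ^+ (2 * k)
  <= (2 ^ (2 * k) * #|E| ^ (2 * k).-1 * p *
       (#|E| * (h ^ k * k ^ k) + m * (s * (2 * k)) * h ^ (2 * k)))%:R.
Proof.
pose phi (x : 'F_p) := x ^- s.
pose S (c : 'F_p -> R) := \sum_lam normc (expsum c phi lam) ^+ (2 * k).
have S_scale n c : S (fun x => n%:R * c x) = n%:R ^+ (2 * k) * S c.
  rewrite /S mulr_sumr; apply: eq_bigr => lam _.
  by rewrite expsumZ normc_natM exprMn.
pose w (x : 'F_p) : R := (x \in X)%:R * #|G x|%:R.
have weighted : T%:R ^+ (2 * k) * S (fun x => (x \in X)%:R) <= 2 ^+ (2 * k) * S w.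
  rewrite -S_scale -(S_scale 2); apply: moment_le => // x.
  rewrite mulr_ge0 ?ler0n //= /w; case: (boolP (x \in X)) => Xx.
    by rewrite mulr1 mul1r -natrM ler_nat G_large.
  by rewrite mul0r !mulr0.
pose Z (e : 'F_p * 'I_T) := expsum (fun y => (admissible e y)%:R : R) (fun y => phi (point e y)).
have shifted lam : h%:R * expsum w phi lam = \sum_(e in E) Z e lam.
  transitivity (\sum_(e : 'F_p * 'I_T) Z e lam); last first.
    rewrite [RHS]big_mkcond /=; apply: eq_bigr => e _; case: ifPn => // Ee.
    apply: big1 => y _; have -> : admissible e y = false.
      by apply: contraNF Ee; apply: E_admissible.
    by rewrite rmorph0 mul0r.
  rewrite exchange_big /= mulr_natl -[X in _ *+ X]card_ord -sumr_const.
  apply: eq_bigr => y _.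
  rewrite -(pair_bigA _ (fun a t => real_complex R (admissible (a, t) y)%:R
     * epF R (lam * phi (point (a, t) y)))) exchange_big /=.
  transitivity (\sum_(t : 'I_T) \sum_(x : 'F_p)
     real_complex R ((x \in X) && (t \in G x))%:R * epF R (lam * phi x)); last first.
    apply: eq_bigr => t _.
    by rewrite (reindex_inj (addIr (t.+1%:R * (y : nat)%:R))).
  rewrite exchange_big; apply: eq_bigr => x _.
  rewrite -mulr_suml; congr (_ * _); rewrite /w -rmorph_sum; congr (real_complex R _).
  case: (x \in X); last by rewrite mul0r big1.
  rewrite mul1r -sum1_card natr_sum [LHS]big_mkcond.
  by apply: eq_bigr => t _ /=; case: (t \in G x).
have [n k2] : exists n, (2 * k = n.+1)%N by exists (2 * k).-1; rewrite prednK // muln_gt0.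
have holder : h%:R ^+ (2 * k) * S w <=
    #|E|%:R ^+ (2 * k).-1 * \sum_(e in E) \sum_lam normc (Z e lam) ^+ (2 * k).
  rewrite -S_scale; apply: le_trans (_ : _ <= \sum_lam normc (\sum_(e in E) Z e lam) ^+ (2 * k)) _.
    by apply: ler_sum => lam _; rewrite expsumZ shifted.
  by rewrite k2; apply: moment_holder.
have count : \sum_(e in E) \sum_lam normc (Z e lam) ^+ (2 * k) <=
   (p * (#|E| * (h ^ k * k ^ k) + m * (s * (2 * k)) * h ^ (2 * k)))%:R.
  under eq_bigr do rewrite /Z moment_indicator //.
  rewrite -natr_sum ler_nat -big_distrr leq_mul2l; apply/orP; right.
  exact: sum_card_coincidence.
rewrite natrX natrM exprMn [_ ^+ _ * _]mulrC -mulrA.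
apply: le_trans (_ : _ <= h%:R ^+ (2 * k) * (2 ^+ (2 * k) * S w)) _.
  by rewrite ler_wpM2l ?exprn_ge0.
rewrite mulrCA -2!mulnA 2!natrM !natrX ler_wpM2l ?exprn_ge0 //.
by apply: le_trans holder _; rewrite ler_wpM2l ?exprn_ge0.
Qed.

End Progressions.

(** * Steps for which quotients seldom collide *)

(** The translates of [A] by [0, ..., D] are disjoint inside [{0, ..., T + D - 1}]. *)
Lemma card_spaced (T D : nat) (A : {set 'I_T}) :
    (forall t t', t \in A -> t' \in A -> (t < t')%N -> (t + D < t')%N) ->
  (#|A| * D.+1 <= T + D)%N.
Proof.
move=> spaced.
have lt_TD (u : 'I_T * 'I_D.+1) : (u.1 + u.2 < T + D)%N.
  by have := ltn_ord u.1; have := ltn_ord u.2; lia.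
have inj : {in setX A setT &, injective (fun u : 'I_T * 'I_D.+1 => Ordinal (lt_TD u))}.
  move=> [t i] [t' i'] /setXP[/= At _] /setXP[/= At' _] /(congr1 val) /= e.
  have [i_D i'_D] := (ltn_ord i, ltn_ord i').
  have tt' : t = t'.
    apply/val_inj => /=; have := spaced t t' At At'; have := spaced t' t At' At.
    by case: (ltngtP t t') => // _; lia.
  by rewrite tt' in e *; congr (_, _); apply: val_inj => /=; lia.
have := max_card (mem [set Ordinal (lt_TD u) | u in setX A setT]).
by rewrite (card_in_imset inj) cardsX cardsT !card_ord.
Qed.

(** The residues of [d x] in [(0, p)] and in [(- p, 0)] are [d x %% p] and
    [- (p - d x %% p)]; steps dividing one of them are discarded.  When
    [T < 4 B] no [d] is tested, and [T] itself bounds the multiplicity of a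
    quotient. *)
Section GoodSteps.

Variables (p n H h T B : nat).
Hypotheses (p_pr : prime p) (nH_p : (n + H < p)%N) (h_gt0 : (0 < h)%N).
Hypotheses (hT_H : (h * T <= H)%N) (HT_p : (1 < T)%N -> (2 * (H * T) < p)%N).
Hypothesis B_bound : forall c, (0 < c < p)%N -> (size (divisors c) <= B)%N.

Definition residue_interval : {set 'F_p} := [set x : 'F_p | (n < x <= n + H)%N].

Let D := (T %/ (4 * B))%N.

Let T_H : (T <= H)%N. Proof. by apply: leq_trans hT_H; rewrite leq_pmull. Qed.

Let B_gt0 : (0 < B)%N.
Proof. by apply: leq_trans (B_bound (_ : 0 < 1 < p)%N); rewrite // prime_gt1. Qed.

Let p_gt0 := prime_gt0 p_pr.

Definition good_steps (x : 'F_p) : {set 'I_T} :=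
  [set t : 'I_T | [forall d : 'I_D, ~~ (t.+1 %| d.+1 * x %% p)%N &&
                                    ~~ (t.+1 %| p - d.+1 * x %% p)%N]].

Let D_T : (D <= T)%N. Proof. exact: leq_div. Qed.

Let residue_gt0 (x : 'F_p) (d : 'I_D) : x \in residue_interval -> (0 < d.+1 * x %% p < p)%N.
Proof.
rewrite inE ltn_pmod // andbT => /andP[n_x x_nH]; rewrite lt0n -/(_ %| _)%N.
rewrite Euclid_dvdM // negb_or; have := ltn_ord d => d_D.
by rewrite !gtnNdvd //; lia.
Qed.

(** Neither residue of [d x] is zero, so for each [d] they have together at most
    [2 B] divisors. *)
Lemma good_steps_large (x : 'F_p) : x \in residue_interval -> (T <= 2 * #|good_steps x|)%N.
Proof.
move=> Ix.
have bad : (#|~: good_steps x| <= D * (2 * B))%N.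
  have -> : ~: good_steps x = \bigcup_(d : 'I_D)
      ([set t : 'I_T | (t.+1 %| d.+1 * x %% p)%N] :|:
       [set t : 'I_T | (t.+1 %| p - d.+1 * x %% p)%N]).
    apply/setP => t; rewrite !inE negb_forall; apply/existsP/bigcupP.
      case=> d; rewrite negb_and !negbK => td; exists d => //.
      by rewrite !inE.
    by case=> d _; rewrite !inE => td; exists d; rewrite negb_and !negbK.
  have divs c : (0 < c < p)%N -> (#|[set t : 'I_T | t.+1 %| c]%N| <= B)%N.
    move=> c_p; apply: leq_trans (B_bound c_p).
    rewrite cardE -(size_map (fun t : 'I_T => t.+1)); apply: uniq_leq_size.
      rewrite map_inj_uniq ?enum_uniq // => t t' [e]; exact: val_inj.
    move=> d /mapP[t]; rewrite mem_enum inE => tc ->.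
    by rewrite -dvdn_divisors //; case/andP: c_p.
  apply: leq_trans (_ : _ <= \sum_(d : 'I_D) 2 * B)%N _; last first.
    by rewrite sum_nat_const card_ord.
  elim/big_ind2: _ => [|A1 a1 A2 a2 le1 le2|d _]; first by rewrite cards0.
    exact: leq_trans (leq_card_setU _ _) (leq_add le1 le2).
  apply: leq_trans (leq_card_setU _ _) _; have /andP[c0 c_p] := residue_gt0 d Ix.
  by rewrite mul2n -addnn leq_add ?divs ?c0 //; apply/andP; split; lia.
have := cardsC (good_steps x); rewrite card_ord.
have : (D * (4 * B) <= T)%N by exact: leq_divM.
lia.
Qed.

Let point (e : 'F_p * 'I_T) (y : 'I_h) : 'F_p := e.1 + e.2.+1%:R * (y : nat)%:R.
Let admissible e : pred 'I_h :=
  fun y => (point e y \in residue_interval) && (e.2 \in good_steps (point e y)).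

Definition good_progressions : {set 'F_p * 'I_T} :=
  [set e | [exists y : 'I_h, admissible e y]].

(** The origin [x - t y] lies in an interval of length [H + h T <= 2 H]. *)
Lemma card_good_progressions : (#|good_progressions| <= 2 * (H * T))%N.
Proof.
pose f (u : 'I_(2 * H) * 'I_T) : 'F_p * 'I_T := ((n.+1 + u.1)%:R - (T * h)%:R, u.2).
apply: leq_trans (_ : _ <= #|[set f u | u in setT]|)%N _; last first.
  by rewrite (leq_trans (leq_imset_card _ _)) // cardsT card_prod !card_ord mulnA.
apply/subset_leq_card/subsetP => -[a t]; rewrite inE => /existsP[y /andP[]].
set x := point (a, t) y; rewrite inE => /andP[n_x x_nH] _.
have ty : (t.+1 * y <= T * h)%N by rewrite leq_mul // ltnW.
have i_lt : (x - n.+1 + (T * h - t.+1 * y) < 2 * H)%N by move: hT_H; rewrite [(h * T)%N]mulnC; lia.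
apply/imsetP; exists (Ordinal i_lt, t) => //; rewrite /f /=; congr (_, _).
have -> : (n.+1 + (x - n.+1 + (T * h - t.+1 * y)) = x + (T * h) - t.+1 * y)%N by lia.
rewrite natrB; last by rewrite (leq_trans ty) ?leq_addl.
rewrite natrD natr_Zp /x /point !natrM [(a, t).1]/= [(a, t).2]/=.
by ring.
Qed.

(** Suppose [x = t (b + y)] and [x' = t' (b + y')] with [d = t' - t <= D].  Then
    [d x = t d (b + y) = t u] where [u = x' - x + t' (y - y')] is an integer with
    [|u| <= 2 H].  As [2 H T < p], the number [t u] is one of the two residues of
    [d x], and [t] divides it: [t] is not allowed at [x]. *)
Lemma good_progressions_fibre (b : 'F_p) :
  (#|[set t : 'I_T | (b * t.+1%:R, t) \in good_progressions]%R| <= 4 * B)%N.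
Proof.
set A := [set t : 'I_T | _]; rewrite -ltnS -(@ltn_pmul2r D.+1) //.
suff spaced : (#|A| * D.+1 <= T + D)%N.
  have := @ltn_ceil T (4 * B); rewrite muln_gt0 B_gt0 => /(_ isT); rewrite -/D.
  by lia.
apply: card_spaced => t t'; rewrite !inE => /existsP[y /andP[Ix good]] /existsP[y' /andP[Ix' _]] tt'.
rewrite ltnNge; apply/negP => t'_tD.
have d_D : ((t' - t).-1 < D)%N by lia.
have T_gt1 : (1 < T)%N by have := ltn_ord t'; lia.
have HT_lt_p := HT_p T_gt1.
move: Ix Ix' good; set x := point _ y; set x' := point _ y'.
move=> Ix Ix'; rewrite inE => /forallP/(_ (Ordinal d_D)).
have := residue_gt0 (Ordinal d_D) Ix.
have dE : ((t' - t).-1.+1 = t' - t)%N by lia.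
rewrite [nat_of_ord (Ordinal d_D)]/= [(b * t.+1%:R, t).2]/= dE.
set c := (_ %% p)%N => /andP[c_gt0 c_p].
have c_nat : c%:R = (t' - t)%:R * x :> 'F_p.
  by rewrite /c Fp_nat_mod // natrM natr_Zp.
move: Ix Ix'; rewrite !inE => /andP[n_x x_nH] /andP[n_x' x'_nH].
have key : (x' + t'.+1%:R * y%:R - (x + t'.+1%:R * y'%:R)) * t.+1%:R = c%:R.
  have t'E : t'.+1%:R = t.+1%:R + (t' - t)%:R :> 'F_p.
    by rewrite -natrD; congr _%:R; lia.
  rewrite c_nat /x /x' /point [(b * t.+1%:R, t).1]/= [(b * t.+1%:R, t).2]/=.
  rewrite [(b * t'.+1%:R, t').1]/= [(b * t'.+1%:R, t').2]/= t'E.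
  by ring.
have t'y : (t'.+1 * y <= H)%N.
  by apply: leq_trans hT_H; rewrite mulnC; apply: leq_mul => //; apply: ltnW.
have t'y' : (t'.+1 * y' <= H)%N.
  by apply: leq_trans hT_H; rewrite mulnC; apply: leq_mul => //; apply: ltnW.
have [le|lt] := leqP (x + t'.+1 * y') (x' + t'.+1 * y).
  set u := (x' + t'.+1 * y - (x + t'.+1 * y'))%N.
  have tu_p : (t.+1 * u < p)%N.
    apply: leq_ltn_trans HT_lt_p; rewrite mulnA mulnC; apply: leq_mul => //.
    by rewrite /u; lia.
  suff -> : c = (t.+1 * u)%N by rewrite dvdn_mulr.
  have : c%:R = (t.+1 * u)%:R :> 'F_p.
    by rewrite -key /u natrM natrB // !natrD !natrM !natr_Zp; ring.
  by move/(congr1 val); rewrite /= !val_Fp_nat // !modn_small.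
set v := (x + t'.+1 * y' - (x' + t'.+1 * y))%N.
have tv_p : (t.+1 * v < p)%N.
  apply: leq_ltn_trans HT_lt_p; rewrite mulnA mulnC; apply: leq_mul => //.
  by rewrite /v; lia.
(* Here u = - v, and c + t v is a multiple of p strictly between 0 and 2 p. *)
suff -> : (p - c = t.+1 * v)%N by rewrite dvdn_mulr // andbF.
have /eqP : (c + t.+1 * v)%:R = 0 :> 'F_p.
  rewrite natrD -key /v natrM natrB 1?ltnW // !natrD !natrM !natr_Zp; ring.
rewrite -(dvdn_pcharf (pchar_Fp p_pr)) => /dvdnP[q e].
by case: q e => [|[|q]]; lia.
Qed.

End GoodSteps.

(** * The moment over an interval *)

(** [h] is the largest number with [h^k <= p] and [h^(k+1) <= H^2], and [T] is
    [h^k / (4 H)], or [1] if this quotient vanishes.  The first condition gives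
    [2 H T < p] unless [T = 1], the second [h T <= H]; the last clause of the statement is the
    maximality of [h]. *)
Lemma progression_parameters (k p H : nat) : (0 < k)%N -> (0 < H)%N -> (H < p)%N ->
  exists h T : nat, [/\ (0 < h)%N, (0 < T)%N, (h * T <= H)%N,
    ((1 < T)%N -> (2 * (H * T) < p)%N) & (h ^ k <= 8 * (H * T))%N
    /\ ((p < h.+1 ^ k)%N \/ (H ^ 2 < h.+1 ^ k.+1)%N)].
Proof.
move=> k_gt0 H_gt0 H_p.
pose P h := ((h ^ k <= p) && (h ^ k.+1 <= H ^ 2))%N.
have P1 : exists h, P h by exists 1%N; rewrite /P !exp1n expn_gt0 H_gt0; lia.
have P_le h : P h -> (h <= p)%N.
  case/andP => hk _; case: (posnP h) => [->//|h_gt0]; apply: leq_trans hk.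
  by rewrite -[X in (X <= _)%N]expn1 leq_pexp2l.
case: (ex_maxnP P1 P_le) => h /andP[hk_p hk_H] h_max.
have h_gt0 : (0 < h)%N.
  by apply: h_max; rewrite /P !exp1n expn_gt0 H_gt0; lia.
have H4_gt0 : (0 < 4 * H)%N by rewrite muln_gt0.
have ceil := ltn_ceil (h ^ k) H4_gt0; have trunc := leq_divM (h ^ k) (4 * H).
set q := (h ^ k %/ (4 * H))%N in ceil trunc.
exists h, (maxn 1 q).
have large : ((p < h.+1 ^ k)%N \/ (H ^ 2 < h.+1 ^ k.+1)%N).
  have : ~~ P h.+1 by apply: contraT => /negPn/h_max; rewrite ltnn.
  by rewrite negb_and -!ltnNge => /orP[]; [left | right].
have [q_le1|q_gt1] := leqP q 1.
  rewrite muln1; split=> //; last by split=> //; nia.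
  rewrite -(leq_exp2r _ _ (ltn0Sn k)); apply: leq_trans hk_H _.
  by rewrite leq_pexp2l.
split=> //; [lia| |by nia| split=> //; nia].
have : (4 * H * (q * h) <= H * H)%N.
  apply: leq_trans (_ : _ <= h ^ k.+1)%N _; last by rewrite mulnn.
  by rewrite expnSr mulnA leq_mul2r mulnC trunc orbT.
by rewrite -mulnA mulnCA leq_pmul2l // mulnC; lia.
Qed.

(** Both terms of [moment_by_progressions] are of order [H T h^k] for the above
    parameters, up to the factor [B]. *)
Lemma interval_moment (R : realType) (p s k n H B : nat) :
    prime p -> (0 < s)%N -> (0 < k)%N -> (k < p)%N -> (0 < H)%N -> (n + H < p)%N ->
    (forall c, (0 < c < p)%N -> (size (divisors c) <= B)%N) ->
  exists2 h : nat, (0 < h)%N /\ ((p < h.+1 ^ k)%N \/ (H ^ 2 < h.+1 ^ k.+1)%N) &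
    (h ^ k)%:R * \sum_lam normc (expsum (fun x => (x \in residue_interval p n H)%:R : R)
                     (fun x => x ^- s) lam) ^+ (2 * k)
    <= (16 ^ k * H ^ (2 * k) * p * (B * (k ^ k + 32 * (k * s))))%:R.
Proof.
move=> p_pr s_gt0 k_gt0 k_p H_gt0 nH_p B_bound.
have H_p : (H < p)%N by apply: leq_ltn_trans nH_p; apply: leq_addl.
have [h [T [h_gt0 T_gt0 hT_H HT_p [hk h_large]]]] := progression_parameters k_gt0 H_gt0 H_p.
exists h => //.
have T_H : (T <= H)%N by apply: leq_trans hT_H; rewrite leq_pmull.
have h_H : (h <= H)%N by apply: leq_trans hT_H; rewrite leq_pmulr.
have B_gt0 : (0 < B)%N.
  by apply: leq_trans (B_bound 1%N (_ : 0 < 1 < p)%N); rewrite // prime_gt1.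
have X0 : 0 \notin residue_interval p n H by rewrite inE.
set S := \sum_lam _.
pose E := good_progressions p n H h T B.
have E_le : (#|E| <= 2 * (H * T))%N by apply: card_good_progressions.
have fibre (b : 'F_p) : (#|[set t : 'I_T | (b * t.+1%:R, t) \in E]%R| <= 4 * B)%N.
  by apply: good_progressions_fibre.
have large x : x \in residue_interval p n H -> (T <= 2 * #|good_steps T B x|)%N.
  by move=> Xx; apply: (@good_steps_large p n H h T B).
have moment : ((T * h) ^ (2 * k))%:R * S <= (2 ^ (2 * k) * #|E| ^ (2 * k).-1 * p *
    (#|E| * (h ^ k * k ^ k) + 4 * B * (s * (2 * k)) * h ^ (2 * k)))%:R.
  apply: (moment_by_progressions p_pr s_gt0 k_gt0 k_p (leq_trans h_H (ltnW H_p))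
    (leq_ltn_trans T_H H_p) X0 large _ fibre) => e y adm.
  by rewrite inE; apply/existsP; exists y.
set N := (2 * (H * T))%N in E_le.
have bracket : (#|E| * (h ^ k * k ^ k) + 4 * B * (s * (2 * k)) * h ^ (2 * k)
    <= N * (h ^ k * (B * (k ^ k + 32 * (k * s)))))%N.
  apply: leq_trans (_ : _ <= N * (h ^ k * (B * k ^ k)) + N * (h ^ k * (B * (32 * (k * s)))))%N _.
    apply: leq_add; first by rewrite leq_mul // leq_mul // leq_pmull.
    have -> : (h ^ (2 * k) = h ^ k * h ^ k)%N by rewrite mul2n -addnn expnD.
    have : (h ^ k * h ^ k <= h ^ k * (4 * N))%N by rewrite leq_mul2l /N; apply/orP; right; lia.
    move/(leq_mul (leqnn (4 * B * (s * (2 * k)))))/leq_trans; apply.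
    by apply: eq_leq; ring.
  by rewrite -!mulnDr.
have total : ((T * h) ^ (2 * k))%:R * S <=
    ((T * h) ^ k * T ^ k * (16 ^ k * H ^ (2 * k) * p * (B * (k ^ k + 32 * (k * s)))))%:R.
  apply: le_trans moment _; rewrite ler_nat.
  have N_pow : (N ^ (2 * k) = N ^ (2 * k).-1 * N)%N.
    by rewrite -expnSr prednK // muln_gt0.
  apply: leq_trans (_ : _ <= 2 ^ (2 * k) * N ^ (2 * k).-1 * p * (N * (h ^ k * (B * (k ^ k + 32 * (k * s))))))%N _.
    by rewrite leq_mul // leq_mul // leq_mul // leq_exp2r //; lia.
  apply: eq_leq; transitivity (2 ^ (2 * k) * N ^ (2 * k) * p * (h ^ k * (B * (k ^ k + 32 * (k * s)))))%N.
    by rewrite N_pow; ring.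
  have -> : (16 ^ k = 2 ^ (2 * k) * 2 ^ (2 * k))%N by rewrite -expnMn expnM.
  have -> : (N ^ (2 * k) = 2 ^ (2 * k) * H ^ (2 * k) * (T ^ k * T ^ k))%N.
    by rewrite /N !expnMn -expnD addnn -mul2n mulnA.
  by rewrite expnMn; ring.
have Th_gt0 : (0 < ((T * h) ^ k * T ^ k)%:R :> R).
  by rewrite ltr0n muln_gt0 !expn_gt0 muln_gt0 T_gt0 h_gt0.
rewrite -(ler_pM2l Th_gt0) -natrM; apply: le_trans total.
have Th2 : ((T * h) ^ k * T ^ k * h ^ k = (T * h) ^ (2 * k))%N.
  by rewrite -mulnA -expnMn -expnD addnn mul2n.
by rewrite mulrA -natrM Th2.
Qed.

(** * The bilinear bound *)

Lemma inv_power_sum_expsum (R : realType) (p s H n : nat) (a : int) (m : 'F_p) :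
    prime p -> (n + H < p)%N ->
  inv_power_sum R s H n%:Z a m =
  expsum (fun x => (x \in residue_interval p n H)%:R : R) (fun x => x ^- s) (a%:~R * m).
Proof.
move=> p_pr nH_p; pose f (i : 'I_H) : 'F_p := (n + i.+1)%:R.
have val_f i : nat_of_ord (f i) = (n + i.+1)%N.
  by have := ltn_ord i => i_H; rewrite /f val_Fp_nat // modn_small //; lia.
have f_inj : injective f.
  by move=> i j /(congr1 (@nat_of_ord _)); rewrite !val_f => e; apply/val_inj => /=; lia.
have intervalE : residue_interval p n H = [set f i | i in 'I_H].
  apply/setP => x; rewrite inE; apply/idP/imsetP => [/andP[n_x x_nH]|[i _ ->]]; last first.
    by rewrite val_f; have := ltn_ord i; lia.
  have i_H : (x - n.+1 < H)%N by lia.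
  exists (Ordinal i_H) => //; rewrite /f /= -[x in LHS]natr_Zp; congr _%:R; lia.
rewrite /inv_power_sum /expsum big_add1 /= big_mkord.
transitivity (\sum_(x in residue_interval p n H) epF R (a%:~R * m * x ^- s)).
  rewrite intervalE big_imset /=; last by move=> i j _ _; apply: f_inj.
  by apply: eq_bigr => i _; rewrite -PoszD.
rewrite [LHS]big_mkcond; apply: eq_bigr => x _.
by case: (x \in _); rewrite ?rmorph1 ?mul1r ?rmorph0 ?mul0r.
Qed.

(** A reformulation of [1 / h^k <= 2^k (1 / p + H^(-2k/(k+1)))], which says that
    [h^k] is at least of the order of [min(p, H^(2k/(k+1)))]. *)
Lemma scale_lower_bound (R : realType) (k p H h : nat) :
    (0 < k)%N -> (0 < p)%N -> (0 < H)%N -> (0 < h)%N ->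
    (p < h.+1 ^ k)%N \/ (H ^ 2 < h.+1 ^ k.+1)%N ->
  p%:R <= 2 ^+ k * (h ^ k)%:R * (p%:R / H%:R `^ (2 * k%:R / (k%:R + 1)) + 1) :> R.
Proof.
move=> k_gt0 p_gt0 H_gt0 h_gt0 large.
set beta := H%:R `^ _.
have beta_gt0 : 0 < beta by rewrite powR_gt0 // ltr0n.
have hh : (h.+1 <= 2 * h)%N by lia.
have p_ge0 : (0 : R) <= p%:R by rewrite ler0n.
have hk_ge0 : (0 : R) <= 2 ^+ k * (h ^ k)%:R by rewrite mulr_ge0 ?exprn_ge0.
have hkE : 2 ^+ k * (h ^ k)%:R = (2 * h%:R) ^+ k :> R by rewrite natrX exprMn.
case: large => [large|large].
  apply: le_trans (_ : _ <= 2 ^+ k * (h ^ k)%:R) _.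
    rewrite hkE -natrM -natrX ler_nat; apply: leq_trans (ltnW large) _.
    by rewrite leq_exp2r.
  by rewrite ler_peMr // lerDr divr_ge0 // ltW.
have beta_le : beta <= 2 ^+ k * (h ^ k)%:R.
  have k1 : (k%:R + 1 : R) != 0 by rewrite natr1 pnatr_eq0.
  rewrite /beta hkE.
  have -> : 2 * k%:R / (k%:R + 1) = 2 * (k%:R / (k%:R + 1)) :> R by rewrite mulrA.
  have -> : (2 * h%:R) ^+ k = ((2 * h%:R) `^ (k.+1)%:R) `^ (k%:R / (k%:R + 1)) :> R.
    by rewrite -powRrM -[k.+1%:R]natr1 mulrCA mulfV // mulr1 powR_mulrn // mulr_ge0.
  rewrite powRrM ge0_ler_powR ?nnegrE ?powR_ge0 ?divr_ge0 ?addr_ge0 //.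
  rewrite (powR_mulrn 2) // powR_mulrn ?mulr_ge0 // -natrM -!natrX ler_nat.
  by apply: leq_trans (ltnW large) _; rewrite leq_exp2r.
apply: le_trans (_ : _ <= 2 ^+ k * (h ^ k)%:R * (p%:R / beta)) _; last first.
  by rewrite ler_wpM2l // lerDl.
by rewrite mulrCA ler_peMr // ler_pdivlMr // mul1r.
Qed.

Lemma divisor_bound_below (j C p : nat) :
    (forall n, (0 < n)%N -> (size (divisors n) ^ j <= C * n)%N) -> (0 < j)%N ->
  exists B : nat, (forall c, (0 < c < p)%N -> (size (divisors c) <= B)%N) /\ (B ^ j <= C * p)%N.
Proof.
move=> tau j_gt0; exists (\max_(c < p | (0 < c)%N) size (divisors c))%N; split.
  move=> c /andP[c_gt0 c_p].
  exact: (@leq_bigmax_cond _ (fun c : 'I_p => (0 < c)%N)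
    (fun c : 'I_p => size (divisors c)) (Ordinal c_p)).
elim/big_ind: _ => [|x y x_le y_le|c c_gt0]; first by rewrite exp0n.
  by rewrite /maxn; case: ifP.
by apply: leq_trans (tau c c_gt0) _; rewrite leq_mul2l ltnW ?orbT.
Qed.

Theorem theorem1p2 (R : realType) (s l : nat) (s_gt0 : (0 < s)%N)
    (l_gt0 : (0 < l)%N) (kappa : R) (kappa_gt0 : 0 < kappa) :
  exists p0 : nat, forall p : nat, prime p -> (p0 <= p)%N ->
  forall (H : nat) (L : int) (M : {set 'F_p}) (a : int),
    (1 <= H)%N ->
    (forall h : nat, (1 <= h <= H)%N -> 1 <= L + h%:Z <= p%:Z - 1) ->
    0 \notin M -> (1 <= #|M|)%N ->
    coprimez a p%:Z ->
    \sum_(m in M) ComplexField.Normc.normc (inv_power_sum R s H L a m)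
    <= H%:R * #|M|%:R *
       (p%:R / (#|M|%:R * H%:R `^ (2 * l%:R / (l%:R + 1))) + 1 / #|M|%:R)
         `^ (1 / (2 * l%:R)) * p%:R `^ kappa.
Proof.
(* With j >= 2 / kappa, the divisor bound B^j <= C p yields (K B)^j <= p^2 <= p^(kappa j)
   once p >= K^j C; so K B, which collects all the losses, is at most p^kappa. *)
pose j := (Num.bound (2 / kappa)).+1.
have j_gt0 : (0 < j)%N by [].
have j_kappa : 2 <= kappa * j%:R.
  rewrite -ler_pdivrMl // mulrC; apply: ltW.
  apply: lt_trans (archi_boundP _) _; first by rewrite divr_ge0 // ltW.
  by rewrite ltr_nat.
have [C tau] := divisor_bound j_gt0.
pose K := (32 ^ l * (l ^ l + 32 * (l * s)))%N.
exists (K ^ j * C + l.+1)%N => p p_pr p_large H L M a H_gt0 L_range _ M_gt0 a_p.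
have p_gt0 := prime_gt0 p_pr.
have l_p : (l < p)%N by apply: leq_trans p_large; apply: leq_addl.
have [n Ln nH_p] : exists2 n : nat, L = n%:Z & (n + H < p)%N.
  have := L_range 1%N; have := L_range H; rewrite H_gt0 leqnn => /(_ isT) LH /(_ isT) L1.
  exists `|L|%N; lia.
have [B [B_bound B_pow]] := divisor_bound_below p tau j_gt0.
have [h [h_gt0 h_large] moment] := interval_moment R p_pr s_gt0 l_gt0 l_p H_gt0 nH_p B_bound.
set S := expsum _ _ in moment; set mom := \sum_lam _ in moment.
have a_neq0 : a%:~R != 0 :> 'F_p.
  rewrite -(dvdz_pcharf (pchar_Fp p_pr)); apply/negP => p_a.
  move: a_p; rewrite /coprimez /gcdz (gcdn_idPr _) // => /eqP[p1].
  by move: (prime_gt1 p_pr); rewrite p1.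
have sumE : \sum_(m in M) normc (inv_power_sum R s H L a m) = \sum_(m in M) normc (S (a%:~R * m)).
  by apply: eq_bigr => m _; rewrite Ln inv_power_sum_expsum.
rewrite sumE.
have mom_M : \sum_(m in M) normc (S (a%:~R * m)) ^+ (2 * l) <= mom.
  rewrite /mom [leRHS](reindex_inj (mulfI a_neq0)).
  rewrite [leLHS]big_mkcond; apply: ler_sum => m _.
  by case: ifP => [_|_]; [exact: lexx | exact/exprn_ge0/normc_ge0].
set beta := H%:R `^ _.
set W := p%:R / _ + _.
have beta_gt0 : 0 < beta by rewrite powR_gt0 // ltr0n.
have MR_gt0 : (0 : R) < #|M|%:R by rewrite ltr0n.
have pR_gt0 : (0 : R) < p%:R by rewrite ltr0n.
have W_ge0 : 0 <= W by rewrite addr_ge0 ?divr_ge0 ?mulr_ge0 // ltW.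
have WE : W * #|M|%:R = p%:R / beta + 1.
  by rewrite /W; field; rewrite ?gt_eqF.
have l2E : (2 * l = (2 * l).-1.+1)%N by rewrite prednK // muln_gt0.
have KB : (K * B)%:R <= p%:R `^ kappa :> R.
  rewrite -(@ler_pXn2r _ j) ?nnegrE ?powR_ge0 //.
  rewrite -[leRHS](powR_mulrn j) ?powR_ge0 // -powRrM.
  apply: le_trans (_ : p%:R `^ 2%:R <= _); last first.
    by apply: ler_powR => //; rewrite ler1n.
  rewrite powR_mulrn ?ler0n // -!natrX ler_nat expnMn.
  apply: leq_trans (_ : _ <= K ^ j * C * p)%N _; first by rewrite -mulnA leq_mul2l B_pow orbT.
  by rewrite -mulnn leq_mul2r; apply/orP; right; lia.
have mom_le : mom <= H%:R ^+ (2 * l) * (W * #|M|%:R) * (K * B)%:R.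
  have hl_gt0 : (0 : R) < (h ^ l)%:R by rewrite ltr0n expn_gt0 h_gt0.
  rewrite WE -(ler_pM2l hl_gt0); apply: le_trans moment _.
  have scale := scale_lower_bound R l_gt0 p_gt0 H_gt0 h_gt0 h_large.
  have -> : (16 ^ l * H ^ (2 * l) * p * (B * (l ^ l + 32 * (l * s))))%:R
      = H%:R ^+ (2 * l) * (16 ^ l * (B * (l ^ l + 32 * (l * s))))%:R * p%:R :> R.
    by rewrite -natrX -!natrM; congr _%:R; ring.
  apply: le_trans (ler_wpM2l _ scale) _; first by rewrite mulr_ge0 ?exprn_ge0.
  have -> : (K * B)%:R = (16 ^ l * (B * (l ^ l + 32 * (l * s))))%:R * 2 ^+ l :> R.
    have -> : K = (16 ^ l * 2 ^ l * (l ^ l + 32 * (l * s)))%N by rewrite -expnMn.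
    by rewrite -natrX -natrM; congr _%:R; ring.
  by rewrite le_eqVlt; apply/orP; left; apply/eqP; rewrite -/beta; ring.
have rhs_pow : (H%:R * #|M|%:R * W `^ (1 / (2 * l%:R)) * p%:R `^ kappa) ^+ (2 * l)
    = (H%:R * #|M|%:R) ^+ (2 * l) * W * (p%:R `^ kappa) ^+ (2 * l).
  rewrite !exprMn; congr (_ * _ * _).
  rewrite -powR_mulrn ?powR_ge0 // -powRrM natrM mul1r mulVf ?powRr1 //.
  by rewrite mulf_neq0 // pnatr_eq0 -lt0n.
have l2_gt0 : (0 < 2 * l)%N by rewrite muln_gt0.
rewrite -(ler_pXn2r l2_gt0) ?nnegrE; last 2 first.
- by apply: sumr_ge0 => m _; apply: normc_ge0.
- by rewrite !mulr_ge0 ?powR_ge0.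
rewrite rhs_pow {1}l2E.
apply: le_trans (power_mean M _ (fun m => normc_ge0 (S (a%:~R * m)))) _.
rewrite -l2E; apply: le_trans (ler_wpM2l _ (le_trans mom_M mom_le)) _.
  by rewrite exprn_ge0.
have -> : #|M|%:R ^+ (2 * l).-1 * (H%:R ^+ (2 * l) * (W * #|M|%:R) * (K * B)%:R)
   = (H%:R * #|M|%:R) ^+ (2 * l) * W * (K * B)%:R :> R.
  by rewrite exprMn {4}l2E exprSr; ring.
apply: ler_wpM2l; first by rewrite mulr_ge0 ?exprn_ge0 ?mulr_ge0.
apply: le_trans KB _; rewrite l2E ler_eXnr //.
by rewrite -[leLHS](powRr0 p%:R) ler_powR ?ler1n // ltW.
Qed.
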